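(* For every integer $n \geq 373$, $p_{od}^{eu}(n) < p_{eu}^{od}(n)$.
   Context: A partition of a positive integer $n$ is a finite non-increasing sequence of positive integers (its parts) summing to $n$. Let $p_{od}^{eu}(n)$ denote the number of partitions of $n$ in which every even part is strictly larger than every odd part, even parts may be repeated arbitrarily, and odd parts are distinct. Let $p_{eu}^{od}(n)$ denote the number of partitions of $n$ in which every odd part is strictly larger than every even part, odd parts are distinct, and even parts may be repeated arbitrarily. In both cases, partitions with no even parts or with no odd parts are allowed. *)

(* Defs.v *)
From mathcomp Require Import all_boot.
Set Implicit Arguments. Unset Strict Implicit. Unset Printing Implicit Defensive.

(* A partition of n is encoded as a weakly decreasing n-tuple of naturals
   (each <= n) summing to n, padded with zeros at the end: its parts are
   the nonzero entries.  This is a bijection with partitions of n, since a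
   partition of n has at most n parts, each at most n. *)
Definition entries (n : nat) (t : n.-tuple 'I_n.+1) : seq nat :=
  [seq val i | i <- t].

Definition is_partition (n : nat) (t : n.-tuple 'I_n.+1) : bool :=
  sorted geq (entries t) && (sumn (entries t) == n).

Definition parts (n : nat) (t : n.-tuple 'I_n.+1) : seq nat :=
  [seq x <- entries t | 0 < x].

Definition odd_parts (s : seq nat) := [seq x <- s | odd x].
Definition even_parts (s : seq nat) := [seq x <- s | ~~ odd x].

Definition cond_od_eu (s : seq nat) : bool :=
  uniq (odd_parts s) &&
  all (fun e => all (fun o => o < e) (odd_parts s)) (even_parts s).

Definition cond_eu_od (s : seq nat) : bool :=
  uniq (odd_parts s) &&
  all (fun o => all (fun e => e < o) (even_parts s)) (odd_parts s).

Definition p_od_eu (n : nat) : nat :=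
  #|[set t : n.-tuple 'I_n.+1 | is_partition t && cond_od_eu (parts t)]|.

Definition p_eu_od (n : nat) : nat :=
  #|[set t : n.-tuple 'I_n.+1 | is_partition t && cond_eu_od (parts t)]|.

(* Main.v *)
Require Import Defs.
From mathcomp Require Import all_boot.
From mathcomp Require Import zify.

(** Let [r] be the number of odd parts, so that the odd parts exceed the
    staircase [2r-1, ..., 3, 1] by [2 lam], with [lam] weakly decreasing of
    length [r] and possibly ending in zeros.

    When the odd parts are the large ones, the even parts [2 mu] continue the
    sequence: [lam ++ mu] is an arbitrary partition [k] of [(n - r^2)/2], so
    p_eu_od(n) = \sum_r p((n - r^2)/2).  When the even parts are the large ones,
    the partition is a pair [(lam, mu)] with every part of [mu] at least
    [lam_1 + r].

    For [r >= 2] such pairs inject, up to one exception, into the partitions of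
    [(n - r^2)/2]: lower every part of [mu] by [r] and add [r * size mu] parts 1.
    The number of parts is then congruent modulo [r + 1] to the number [i] of
    positive parts of [lam].  If [i = 0] one keeps [mu] itself, unless it has at
    most [r] parts, in which case it goes to a partition whose number of parts
    is divisible by [r + 1].  The exceptions, where [lam = 0] and [mu] has one part,
    go to hooks left free at [r = 2] (even [n]) or [r = 3] (odd [n]), which are not
    exhausted.  For odd [n] the pairs with [r = 1] and [lam] positive are in excess as
    well, and also fit into the room left at [r = 3]. *)

Set Implicit Arguments. Unset Strict Implicit. Unset Printing Implicit Defensive.

(** * Partitions as sequences *)

Definition is_part (n : nat) (s : seq nat) : bool :=
  [&& sorted geq s, all (leq 1) s & sumn s == n].

Lemma geq_trans : transitive geq.
Proof. by move=> y x z /= yx zy; apply: leq_trans yx. Qed.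

Lemma sorted_geq_cat (s1 s2 : seq nat) :
  sorted geq (s1 ++ s2) = [&& allrel geq s1 s2, sorted geq s1 & sorted geq s2].
Proof. by rewrite !(sorted_pairwise geq_trans) pairwise_cat. Qed.

Lemma sorted_nseq (k x : nat) : sorted geq (nseq k x).
Proof. by elim: k => [|[|k] IH] //=; rewrite leqnn. Qed.

(** Once the head fails [P], so does everything after it, since a later element satisfying [P] would
    exceed the head. *)
Lemma sorted_filter_cat (P : pred nat) (s : seq nat) :
  sorted geq s -> {in s &, forall x y, P x -> ~~ P y -> y < x} ->
  s = filter P s ++ filter (predC P) s.
Proof.
elim: s => //= x s IH xs sep.
have {}IH := IH (path_sorted xs) (sub_in2 (mem_behead (s := x :: s)) sep).
case: ifP => Px /=; first by rewrite {1}IH.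
have/(all_filterP) E : all (predC P) s.
  apply/allP => y ys /=; apply/negP => Py.
  have := sep y x; rewrite !inE ys eqxx orbT Py Px => /(_ isT isT isT isT).
  by rewrite ltnNge; move: xs; rewrite (path_sortedE geq_trans) => /andP[/allP/(_ y ys)/= ->].
have -> : filter P s = [::].
  apply/eqP; rewrite -size_eq0 size_filter -leqn0 leqNgt -has_count.
  by rewrite -all_predC -E; apply/all_filterP; rewrite filter_id.
by rewrite /= E.
Qed.

Lemma filter_pos_nseq (s : seq nat) :
  filter (predC (leq 1)) s = nseq (size s - size (filter (leq 1) s)) 0.
Proof.
rewrite [size (filter _ s)]size_filter -(count_predC (leq 1) s) addKn -size_filter.
by apply/all_pred1P/allP => x; rewrite mem_filter /=; case: x.
Qed.

Lemma sorted_geq_pos (s : seq nat) : sorted geq s ->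
  s = filter (leq 1) s ++ nseq (size s - size (filter (leq 1) s)) 0.
Proof.
move=> ss; rewrite -filter_pos_nseq; apply: sorted_filter_cat => //.
by move=> x y _ _; case: y.
Qed.

(** The default value 0 of [nth] supplies the trailing zeros. *)
Definition pad (n : nat) (s : seq nat) : n.-tuple 'I_n.+1 :=
  [tuple inord (nth 0 s i) | i < n].

Lemma size_le_sumn (s : seq nat) : all (leq 1) s -> size s <= sumn s.
Proof. by elim: s => //= x s IH /andP[x1 /IH]; lia. Qed.

Lemma mem_le_sumn (s : seq nat) (x : nat) : x \in s -> x <= sumn s.
Proof. by elim: s => //= y s IH; rewrite inE => /orP[/eqP->|/IH]; lia. Qed.

Lemma entries_pad (n : nat) (s : seq nat) : is_part n s ->
  entries (pad n s) = s ++ nseq (n - size s) 0.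
Proof.
case/and3P=> _ pos /eqP sn.
have szn : size s <= n by rewrite -sn size_le_sumn.
apply: (@eq_from_nth _ 0) => [|i]; rewrite /entries size_map size_tuple.
  by rewrite size_cat size_nseq subnKC.
move=> lt_in; rewrite (nth_map ord0) ?size_tuple // -[i]/(nat_of_ord (Ordinal lt_in)).
rewrite -tnth_nth tnth_mktuple /= inordK; last first.
  rewrite ltnS; case: (ltnP i (size s)) => h; last by rewrite nth_default.
  by rewrite -[leqRHS]sn mem_le_sumn ?mem_nth.
rewrite nth_cat; case: ltnP => // h; rewrite nth_nseq nth_default //.
by case: ifP.
Qed.

Lemma parts_pad (n : nat) (s : seq nat) : is_part n s -> parts (pad n s) = s.
Proof.
move=> ps; rewrite /parts (entries_pad ps) filter_cat filter_nseq /= cats0.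
by apply/all_filterP; case/and3P: ps.
Qed.

Lemma is_partition_pad (n : nat) (s : seq nat) :
  is_part n s -> is_partition (pad n s).
Proof.
move=> ps; rewrite /is_partition (entries_pad ps); case/and3P: ps => ss pos sn.
rewrite sumn_cat sumn_nseq mul0n addn0 sn andbT sorted_geq_cat ss sorted_nseq !andbT.
by apply/allrelP => x y _ /nseqP[-> _] /=.
Qed.

Lemma is_part_parts (n : nat) (t : n.-tuple 'I_n.+1) :
  is_partition t -> is_part n (parts t).
Proof.
case/andP=> st /eqP sn; rewrite /is_part filter_all (sorted_filter geq_trans) //=.
move: sn; rewrite {1}(sorted_geq_pos st) sumn_cat sumn_nseq mul0n addn0.
by move=> sn; apply/eqP; rewrite -[RHS]sn.
Qed.

Lemma parts_inj (n : nat) :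
  {in [pred t : n.-tuple 'I_n.+1 | is_partition t] &, injective (@parts n)}.
Proof.
move=> t u /andP[st _] /andP[su _] e; apply/val_inj/(inj_map val_inj).
rewrite -[LHS]/(entries t) -[RHS]/(entries u).
rewrite (sorted_geq_pos st) (sorted_geq_pos su) -!/(parts _) e.
by rewrite /entries !size_map !size_tuple.
Qed.

(** Moves the counting from tuples to sequences: [g] is the injection, and the missed value [w]
    makes the inequality strict. *)
Lemma card_parts_lt (n : nat) (P Q : pred (seq nat)) (g : seq nat -> seq nat) (w : seq nat) :
  (forall s, is_part n s -> P s -> [&& is_part n (g s), Q (g s) & g s != w]) ->
  {in [pred s | is_part n s && P s] &, injective g} ->
  is_part n w -> Q w ->
  #|[set t : n.-tuple 'I_n.+1 | is_partition t && P (parts t)]| <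
  #|[set t : n.-tuple 'I_n.+1 | is_partition t && Q (parts t)]|.
Proof.
move=> gP gI pw Qw; pose f (t : n.-tuple 'I_n.+1) := pad n (g (parts t)).
rewrite -(@card_in_imset _ _ f); last first.
  move=> t u; rewrite !inE => /andP[pt Pt] /andP[pu Pu] /(congr1 (@parts n)).
  have [pt' pu'] := (is_part_parts pt, is_part_parts pu).
  case/and3P: (gP _ pt' Pt) (gP _ pu' Pu) => pgt _ _ /and3P[pgu _ _].
  rewrite !parts_pad // => /gI e; apply: parts_inj => //.
  by apply: e; rewrite inE ?pt' ?pu'.
apply: proper_card; apply/properP; split.
  apply/subsetP => _ /imsetP[t + ->]; rewrite !inE => /andP[pt Pt].
  case/and3P: (gP _ (is_part_parts pt) Pt) => pgt Qg _.
  by rewrite is_partition_pad ?parts_pad.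
exists (pad n w); first by rewrite inE is_partition_pad ?parts_pad.
apply/imsetP => -[t + /(congr1 (@parts n))]; rewrite inE => /andP[pt Pt].
case/and3P: (gP _ (is_part_parts pt) Pt) => pgt _.
by rewrite !parts_pad // => /eqP h /esym.
Qed.

(** * Staircases *)

Fixpoint stair (l : seq nat) : seq nat :=
  if l is x :: l' then (x + size l').*2.+1 :: stair l' else [::].

Fixpoint unstair (s : seq nat) : seq nat :=
  if s is y :: s' then y./2 - size s' :: unstair s' else [::].

Lemma size_unstair (s : seq nat) : size (unstair s) = size s.
Proof. by elim: s => //= x s ->. Qed.

Lemma all_odd_stair (l : seq nat) : all odd (stair l).
Proof. by elim: l => //= x l ->; rewrite odd_double. Qed.

Lemma sumn_stair (l : seq nat) : sumn (stair l) = (sumn l).*2 + size l ^ 2.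
Proof. by elim: l => //= x l ->; nia. Qed.

Lemma stair_inj : injective stair.
Proof.
elim=> [|x l IH] [|y k] //= [e /IH lk]; rewrite lk in e *.
by congr (_ :: _); lia.
Qed.

Lemma stair_lb (x y : nat) (l : seq nat) : all (leq x) l -> y \in stair l -> x.*2 < y.
Proof.
elim: l => //= z l IH /andP[xz /IH{}IH]; rewrite inE => /orP[/eqP->|//].
lia.
Qed.

Lemma sorted_stair (l : seq nat) : sorted geq l -> sorted gtn (stair l).
Proof. by elim: l => // x [|y l] //= IH /andP[yx /IH ->]; rewrite andbT; lia. Qed.

Lemma sorted_unstair (s : seq nat) :
  sorted gtn s -> all odd s -> sorted geq (unstair s).
Proof.
elim: s => // x [|y s] //= IH /andP[yx ys] /andP[ox oys].
rewrite IH // andbT; move: oys => /andP[oy _]; move: (size s) => k; lia.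
Qed.

(** The largest of r distinct odd numbers is at least 2r - 1; hence the subtraction in [unstair]
    never truncates. *)
Lemma unstair_half_ge (s : seq nat) : sorted gtn s -> all odd s ->
  size s <= (head 0 s).+1./2.
Proof.
elim: s => // x [|y s] /= IH; first by case: x.
case/andP=> yx ys /andP[ox oys]; have := IH ys oys; move: oys => /andP[oy _]; lia.
Qed.

Lemma unstairK (s : seq nat) : sorted gtn s -> all odd s -> stair (unstair s) = s.
Proof.
elim: s => //= x s IH xs /andP[ox os]; rewrite IH ?(path_sorted xs) // size_unstair.
have := @unstair_half_ge (x :: s) xs; rewrite /= ox os => /(_ isT).
by move=> h; congr (_ :: _); lia.
Qed.

Lemma sumn_double (l : seq nat) : sumn (map double l) = (sumn l).*2.
Proof. by elim: l => //= x l ->; lia. Qed.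

Lemma half_doubles (s : seq nat) : all (predC odd) s -> map double (map half s) = s.
Proof. by elim: s => //= x s IH /andP[ox /IH->]; congr (_ :: _); lia. Qed.

(* [d = (lam, mu)]: the partitions counted by [p_od_eu]. *)
Definition valid (n : nat) (d : seq nat * seq nat) : bool :=
  [&& sorted geq d.1, sorted geq d.2, all (leq (head 0 d.1 + size d.1)) d.2,
   all (leq 1) d.2 & (sumn d.1 + sumn d.2).*2 + size d.1 ^ 2 == n].

Definition decode (s : seq nat) : seq nat * seq nat :=
  (unstair (odd_parts s), map half (even_parts s)).

Lemma sorted_geq_halves (s : seq nat) : sorted geq s -> sorted geq (map half s).
Proof.
move=> ss; rewrite sorted_map; apply: sub_sorted ss => x y /=; lia.
Qed.

Lemma decode_odd_strict (s : seq nat) : sorted geq s -> uniq (odd_parts s) ->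
  sorted gtn (odd_parts s).
Proof.
by move=> ss us; rewrite gtn_sorted_uniq_geq us (sorted_filter geq_trans).
Qed.

Lemma decode_valid (n : nat) (s : seq nat) :
  is_part n s -> cond_od_eu s -> valid n (decode s).
Proof.
case/and3P=> ss ps sn /andP[us sep].
have so := decode_odd_strict ss us.
have ao : all odd (odd_parts s) by apply: filter_all.
have ae : all (predC odd) (even_parts s) by apply: filter_all.
apply/and5P; split=> /=.
- exact: sorted_unstair.
- by apply: sorted_geq_halves; apply: sorted_filter ss; apply: geq_trans.
(* The largest odd part is 2 (lam_1 + r) - 1, so an even part above it has half at least lam_1 +
   r. *)
- rewrite all_map; apply/allP => e ees /=.
  have {sep} := allP sep e ees; have := allP ae e ees.
  move: so ao; rewrite size_unstair; case: (odd_parts s) => [|o os] //= so /andP[oo aos] oe.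
  case/andP=> lo _; have := @unstair_half_ge (o :: os) so.
  by rewrite /= oo aos => /(_ isT); lia.
- rewrite all_map; apply/allP => e ees /=.
  have : e \in s by move: ees; rewrite mem_filter => /andP[].
  by move/(allP ps); have /= := allP ae e ees; lia.
- rewrite -(eqP sn) (perm_sumn (_ : perm_eq s (odd_parts s ++ even_parts s))).
    have := sumn_stair (unstair (odd_parts s)); rewrite unstairK // sumn_cat => ->.
    by have := sumn_double (map half (even_parts s)); rewrite half_doubles // => ->; lia.
  by rewrite perm_sym perm_filterC.
Qed.

Lemma decode_inj (n : nat) :
  {in [pred s | is_part n s && cond_od_eu s] &, injective decode}.
Proof.
suff K s : is_part n s -> cond_od_eu s ->
    s = map double (decode s).2 ++ stair (decode s).1.
  by move=> s t /andP[ps Ps] /andP[pt Pt] e; rewrite (K s) // (K t) // e.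
case/and3P=> ss ps sn /andP[us sep] /=.
rewrite unstairK ?filter_all ?decode_odd_strict // half_doubles ?filter_all //.
rewrite {1}(sorted_filter_cat (P := predC odd) ss).
  by congr (_ ++ _); apply: eq_filter => x /=; rewrite negbK.
move=> x y xs ys /= ex; rewrite negbK => oy.
by apply: (allP (allP sep x _) y); rewrite mem_filter ?ex ?oy.
Qed.

(** The zeros pad [k] when it has fewer than [r] parts, so that there are always exactly [r] odd
    parts. *)
Definition encode (d : nat * seq nat) : seq nat :=
  stair (take d.1 (d.2 ++ nseq d.1 0)) ++ map double (drop d.1 d.2).

Lemma size_encode_stair (d : nat * seq nat) : size (take d.1 (d.2 ++ nseq d.1 0)) = d.1.
Proof. by apply: size_takel; rewrite size_cat size_nseq leq_addl. Qed.

Lemma encode_split (d : nat * seq nat) :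
  exists k, take d.1 (d.2 ++ nseq d.1 0) ++ drop d.1 d.2 = take d.1 d.2 ++ nseq k 0 ++ drop d.1 d.2
   /\ (d.2 = take d.1 d.2 ++ drop d.1 d.2) /\ (drop d.1 d.2 = [::] \/ k = 0).
Proof.
exists (d.1 - size d.2); rewrite take_cat cat_take_drop; split; last first.
  by split=> //; case: (leqP (size d.2) d.1) => h; [left; apply: drop_oversize | right; lia].
case: ltnP => h; first by rewrite (_ : d.1 - size d.2 = 0) //; lia.
by rewrite [take _ d.2]take_oversize // take_nseq ?leq_subr // -catA.
Qed.

(* [d = (r, k)]: the partitions counted by [p_eu_od]. *)
Definition target (n : nat) (d : nat * seq nat) : bool :=
  [&& sorted geq d.2, all (leq 1) d.2 & (sumn d.2).*2 + d.1 ^ 2 == n].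

Lemma odd_parts_encode (d : nat * seq nat) :
  odd_parts (encode d) = stair (take d.1 (d.2 ++ nseq d.1 0)).
Proof.
rewrite /odd_parts filter_cat (all_filterP (all_odd_stair _)).
by rewrite filter_map (eq_filter (a2 := pred0)) ?filter_pred0 ?cats0 // => x /=; rewrite odd_double.
Qed.

Lemma even_parts_encode (d : nat * seq nat) :
  even_parts (encode d) = map double (drop d.1 d.2).
Proof.
rewrite /even_parts filter_cat (eq_in_filter (a2 := pred0)); last first.
  by move=> x /(allP (all_odd_stair _)) /= ->.
rewrite filter_pred0 cat0s; apply/all_filterP; rewrite all_map.
by apply/allP => x _ /=; rewrite odd_double.
Qed.

Lemma encodeP (n : nat) (d : nat * seq nat) : target n d ->
  is_part n (encode d) && cond_eu_od (encode d).
Proof.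
case/and3P=> sd pd /eqP nd.
have [k [spl [cat_d drop0]]] := encode_split d.
have sep x y : x \in take d.1 (d.2 ++ nseq d.1 0) -> y \in drop d.1 d.2 -> y <= x.
  move=> xt yd; have k0 : k = 0 by case: drop0 => // e; rewrite e in yd.
  move: spl xt; rewrite k0 /= => /eqP; rewrite eqseq_cat ?size_encode_stair; last first.
    rewrite size_take; case: ltnP => // h; move: yd; rewrite drop_oversize //.
  case/andP=> /eqP -> _ xt; move: sd; rewrite cat_d sorted_geq_cat => /and3P[/allrelP h _ _].
  exact: h.
have slt x y : x \in stair (take d.1 (d.2 ++ nseq d.1 0)) -> y \in map double (drop d.1 d.2) -> y < x.
  move=> xs /mapP[z zd ->]; apply: stair_lb xs; apply/allP => u /sep; exact.
have stk : sorted geq (take d.1 (d.2 ++ nseq d.1 0)).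
  apply: take_sorted; rewrite sorted_geq_cat sd sorted_nseq !andbT.
  by apply/allrelP => x y _ /nseqP[-> _].
have sst := sorted_stair stk.
have ugt : uniq (stair (take d.1 (d.2 ++ nseq d.1 0))).
  by move: sst; rewrite gtn_sorted_uniq_geq => /andP[].
apply/andP; split; [apply/and3P; split|apply/andP; split].
- rewrite sorted_geq_cat; apply/and3P; split.
  + by apply/allrelP => x y xs /(slt _ _ xs) /ltnW.
  + by move: sst; rewrite gtn_sorted_uniq_geq => /andP[].
  + rewrite sorted_map; move: (drop_sorted d.1 sd).
    by apply: sub_sorted => x y /=; rewrite leq_double.
- rewrite all_cat; apply/andP; split.
    by apply: sub_all (all_odd_stair _) => x; case: x.
  rewrite all_map; apply/allP => x /mem_drop /(allP pd) /=; lia.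
- rewrite sumn_cat sumn_stair sumn_double size_encode_stair.
  have := congr1 sumn spl; rewrite !sumn_cat sumn_nseq mul0n add0n => h.
  by apply/eqP; rewrite -nd [in RHS]cat_d sumn_cat; lia.
- by rewrite odd_parts_encode.
- rewrite odd_parts_encode even_parts_encode.
  by apply/allP => x xs; apply/allP => y; apply: slt.
Qed.

(** The number of odd parts gives [r]. Since the parts of [k] are positive, the zeros in the prefix
    are exactly the padding, and deleting them recovers [k]. *)
Lemma encode_inj (n : nat) : {in target n &, injective encode}.
Proof.
move=> d e td te E.
have eqo : take d.1 (d.2 ++ nseq d.1 0) = take e.1 (e.2 ++ nseq e.1 0).
  by apply: stair_inj; rewrite -!odd_parts_encode E.
have eqe : drop d.1 d.2 = drop e.1 e.2.
  by apply: (inj_map double_inj); rewrite -!even_parts_encode E.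
have K x : target n x -> x.2 = filter (leq 1) (take x.1 (x.2 ++ nseq x.1 0)) ++ drop x.1 x.2.
  case/and3P=> _ px _; have [k [spl [cat_x _]]] := encode_split x.
  have /all_filterP <- : all (leq 1) (drop x.1 x.2).
    by apply/allP => y /mem_drop /(allP px).
  rewrite -filter_cat spl !filter_cat filter_nseq /= -filter_cat -cat_x.
  by rewrite (all_filterP px).
have e1 : d.1 = e.1 by rewrite -(size_encode_stair d) eqo size_encode_stair.
have e2 : d.2 = e.2 by rewrite (K d) // (K e) // eqo eqe.
by move: e1 e2; case: (d) (e) => [? ?] [? ?] /= -> ->.
Qed.

(** * The injection *)

Lemma map_subnK (c : nat) (s : seq nat) :
  all (leq c) s -> map (addn c) (map (subn^~ c) s) = s.
Proof. by elim: s => //= x s IH /andP[cx /IH->]; rewrite subnKC. Qed.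

Lemma sumn_map_addn (c : nat) (s : seq nat) :
  sumn (map (addn c) s) = sumn s + c * size s.
Proof. by elim: s => [|x s /= ->] /=; lia. Qed.

Lemma sumn_map_subn (c : nat) (s : seq nat) :
  all (leq c) s -> sumn (map (subn^~ c) s) + c * size s = sumn s.
Proof.
by move=> /map_subnK e; rewrite -{3}e sumn_map_addn size_map.
Qed.

Lemma sorted_map_addn (c : nat) (s : seq nat) : sorted geq s -> sorted geq (map (addn c) s).
Proof. by rewrite sorted_map; apply: sub_sorted => x y /=; rewrite leq_add2l. Qed.

Lemma sorted_map_subn (c : nat) (s : seq nat) : sorted geq s -> sorted geq (map (subn^~ c) s).
Proof. by rewrite sorted_map; apply: sub_sorted => x y /=; apply: leq_sub2r. Qed.

Lemma sorted_geq_cons (x : nat) (s : seq nat) :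
  sorted geq (x :: s) = all (geq x) s && sorted geq s.
Proof. by rewrite /= (path_sortedE geq_trans). Qed.

Lemma sorted_geq_head (s : seq nat) : sorted geq s -> {in s, forall y, y <= head 0 s}.
Proof.
case: s => // x s; rewrite sorted_geq_cons => /andP[/allP xs _] y.
by rewrite inE => /orP[/eqP->|/xs].
Qed.

Lemma sorted_geq_head0 (s : seq nat) :
  sorted geq s -> head 0 s = 0 -> s = nseq (size s) 0.
Proof.
move=> /sorted_geq_head h0 e; apply/all_pred1P/allP => y /h0; rewrite e /=; lia.
Qed.

Lemma sumn_le_head (s : seq nat) : sorted geq s -> sumn s <= size s * head 0 s.
Proof.
move=> /sorted_geq_head; move: (head 0 s) => c.
elim: s => //= x s IH h; have := h x (mem_head _ _).
have {}IH := IH (fun y ys => h y (mem_behead (s := x :: s) ys)); lia.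
Qed.

Lemma count0 (P : pred nat) (s : seq nat) : {in s, forall x, ~~ P x} -> count P s = 0.
Proof. by move=> h; apply/eqP; rewrite -leqn0 leqNgt -has_count; apply/hasPn. Qed.

Definition shear (lam mu : seq nat) : seq nat :=
  map (subn^~ (size lam)) mu ++ filter (leq 1) lam ++ nseq (size lam * size mu) 1.

(** A sheared pair has [i + (r + 1) * size mu] parts with [i <= r], so division by [r + 1] yields
    both [size mu] and [i]. *)
Definition unshear (r : nat) (k : seq nat) : seq nat * seq nat :=
  let i := size k %% r.+1 in let x := size k %/ r.+1 in
  (take i (drop x k) ++ nseq (r - i) 0, map (addn r) (take x k)).

(* Used for [lam = 0] and [1 < size mu <= r]; the result has
   [(r + 1) * (size mu - 1)] parts, a multiple of [r + 1] bounded by [(r + 1) * (r - 1)]. *)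
Definition spread (r : nat) (mu : seq nat) : seq nat :=
  (head 0 mu + 2 - size mu) :: map (subn^~ r.-1) (behead mu)
    ++ nseq (r.+1 * (size mu).-1 - size mu) 1.

Definition unspread (r : nat) (k : seq nat) : seq nat * seq nat :=
  let x := size k %/ r.+1 in
  (nseq r 0, (head 0 k + x.+1 - 2) :: map (addn r.-1) (take x (behead k))).

(** The least rank above 1 with the parity of [n], so that [n - r0 ^ 2] is even. *)
Definition hook_rank (n : nat) : nat := 2 + odd n.

(* The number of parts is a multiple of [r0 + 1] too large for [spread]; the
   offset 12 leaves the hook for [r = 0] unused, and the hooks with
   [r <= sqrt n] all fit once [n >= 373]. *)
Definition hook (n r : nat) : seq nat :=
  let r0 := hook_rank n in let L := r0.+1 * (12 + r) in
  ((n - r0 ^ 2)./2 - L).+1 :: nseq L.-1 1.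

Definition unhook (n r0 : nat) (k : seq nat) : seq nat * seq nat :=
  let r := size k %/ r0.+1 - 12 in (nseq r 0, [:: (n - r ^ 2)./2]).

(* The largest part, lowered to [B], is broken into twos and at most one 3,
   while the other parts are raised above 3.  The result has more than 3 parts,
   a part 2 and no part 1; for [r = 3] neither [shear] nor [spread] produces this. *)
Definition squeeze_few (mu : seq nat) (a : nat) : seq nat :=
  let B := head 0 (rcons mu a) - 4 - 3 * size mu in
  map (addn 3) (behead (rcons mu a)) ++ nseq (odd B) 3 ++ nseq (B - 3 * odd B)./2 2.

Definition unsqueeze_few (k : seq nat) : seq nat * seq nat :=
  let rest := map (subn^~ 3) (filter (leq 4) k) in
  let nu := (sumn (filter (predC (leq 4)) k) + 4 + 3 * size rest) :: rest in
  ([:: last 0 nu], take (size rest) nu).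

Definition ends_two_twos (mu : seq nat) : bool := drop (size mu - 2) mu == [:: 2; 2].

(* Sends the partition [rcons mu a] of [m], whose smallest part [a] is not
   repeated, to a partition of [m - 4], in the room left at [r = 3]: the second
   branch gives exactly one part 1, the third an odd number of parts too few of
   which are 1 for an image of [shear]. *)
Definition squeeze (mu : seq nat) (a : nat) : seq nat :=
  if size mu < 6 then squeeze_few mu a
  else if (a == 1) && ends_two_twos mu then rcons (take (size mu - 2) mu) 1
  else map predn mu ++ a :: nseq (size mu - 4) 1.

(** The last branch of [squeeze] produces [2 * size mu - 3] parts, whence [l = size mu]. *)
Definition unsqueeze (k : seq nat) : seq nat * seq nat :=
  let l := (size k + 3)./2 in ([:: nth 0 k l], map succn (take l k)).

Definition forward (n : nat) (d : seq nat * seq nat) : nat * seq nat :=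
  let: (lam, mu) := d in let r := size lam in
  if r == 0 then (0, mu)
  else if r == 1 then
    if head 0 lam == 0 then (1, mu) else (3, squeeze mu (head 0 lam))
  else if (head 0 lam == 0) && (mu != [::]) then
    if size mu == 1 then (hook_rank n, hook n r)
    else if size mu <= r then (r, spread r mu) else (r, mu)
  else (r, shear lam mu).

(** For [r >= 2] the tests recognise, in order, the images of [shear] with [mu] empty, of an
    unchanged [mu], of the two special branches of [squeeze], of [spread], of [hook], of the last
    branch of [squeeze], and of [shear] with [mu] nonempty. *)
Definition backward (n : nat) (d : nat * seq nat) : seq nat * seq nat :=
  let: (r, k) := d in
  if r == 0 then ([::], k)
  else if r == 1 then ([:: 0], k)
  else if size k <= r then unshear r k
  else if all (leq r) k then (nseq r 0, k)
  else if (r == 3) && (count_mem 1 k <= 1) then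
    if count_mem 1 k == 1 then ([:: 1], take (size k).-1 k ++ [:: 2; 2])
    else unsqueeze_few k
  else if r.+1 %| size k then
    if size k <= r.+1 * r.-1 then unspread r k else unhook n r k
  else if (r == 3) && (size k + 9 < 4 * count (leq 2) k) then unsqueeze k
  else unshear r k.

Lemma count_mem1_nseq (k : nat) : count_mem 1 (nseq k 1) = k.
Proof. by rewrite count_nseq mul1n. Qed.

Lemma size_shear (lam mu : seq nat) :
  size (shear lam mu) = size (filter (leq 1) lam) + (size lam).+1 * size mu.
Proof. by rewrite !size_cat size_map size_nseq; lia. Qed.

Lemma size_pos_le (lam : seq nat) : size (filter (leq 1) lam) <= size lam.
Proof. by rewrite size_filter count_size. Qed.

Lemma unshearK (lam mu : seq nat) : sorted geq lam -> all (leq (size lam)) mu ->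
  unshear (size lam) (shear lam mu) = (lam, mu).
Proof.
move=> sl amu; rewrite /unshear size_shear addnC mulnC.
have lt := size_pos_le lam; rewrite divnMDl // modnMDl !divn_small ?modn_small // addn0.
rewrite /shear drop_size_cat ?size_map // !take_size_cat ?size_map //.
by rewrite map_subnK // -sorted_geq_pos.
Qed.

Lemma shear_target (n : nat) (lam mu : seq nat) : valid n (lam, mu) ->
  (0 < head 0 lam) || (mu == [::]) -> target n (size lam, shear lam mu).
Proof.
case/and5P=> /= sl sm amu _ /eqP sn ne.
(* Lowered by r, the parts of [mu] are still at least lam_1, so they may precede [lam]. *)
have hm x : x \in map (subn^~ (size lam)) mu -> head 0 lam <= x /\ 0 < head 0 lam.
  case/mapP=> y ym ->; have := allP amu y ym; move: ne; case: eqP ym => [->//|_ _].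
  by rewrite orbF => ->; lia.
have hl x : x \in filter (leq 1) lam -> 0 < x <= head 0 lam.
  by rewrite mem_filter => /andP[-> /(sorted_geq_head sl)].
apply/and3P; split=> /=.
- rewrite !sorted_geq_cat sorted_map_subn // (sorted_filter geq_trans) // sorted_nseq !andbT.
  apply/andP; split; apply/allrelP => x y.
    by move/hm=> [h1 h2]; rewrite mem_cat => /orP[/hl|/nseqP[->]] /=; lia.
  by move/hl=> h /nseqP[->] /=; lia.
- rewrite !all_cat; apply/and3P; split; apply/allP => x; [move/hm|move/hl|move/nseqP => [->]] => //=; lia.
- have a2 : all (leq (size lam)) mu by apply: sub_all amu => x; lia.
  have := sumn_map_subn a2; have := congr1 sumn (sorted_geq_pos sl).
  by rewrite !sumn_cat !sumn_nseq; lia.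
Qed.

Lemma backward_shear (n : nat) (lam mu : seq nat) : valid n (lam, mu) ->
  1 < size lam -> (0 < head 0 lam) || (mu == [::]) ->
  backward n (size lam, shear lam mu) = (lam, mu).
Proof.
case/and5P=> /= sl sm amu _ _ r2 ne.
have K : unshear (size lam) (shear lam mu) = (lam, mu).
  by apply: unshearK => //; apply: sub_all amu => x; lia.
rewrite /backward (gtn_eqF (ltnW r2)) (gtn_eqF r2).
case: (leqP (size (shear lam mu))) => // gtL.
have i_le := size_pos_le lam.
have x0 : 0 < size mu.
  by apply: contraTT gtL; rewrite -eqn0Ngt -leqNgt size_shear => /eqP->; rewrite muln0 addn0.
have i0 : 0 < size (filter (leq 1) lam).
  move: ne; rewrite -size_eq0; case: (lam) => [|y l] /=; first by lia.
  by case: (y) => //= ; lia.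
rewrite ifF; last first.
  by apply/negP; rewrite !all_cat !all_nseq => /and3P[_ _]; lia.
have o3 : size lam <= count_mem 1 (shear lam mu).
  by rewrite !count_cat count_mem1_nseq; nia.
rewrite [_ <= 1]leqNgt (leq_trans r2 o3) andbF.
rewrite ifF; last first.
  by rewrite size_shear dvdn_addl ?dvdn_mulr // gtnNdvd.
(* At most [i + size mu] parts exceed 1, and four times this is the number of parts plus [3 * i],
   where [i <= 3]: this is the 9 in the test. *)
rewrite ifF //; apply/negP => /andP[/eqP r3].
rewrite size_shear !count_cat count_nseq /=.
have := count_size (leq 2) (map (subn^~ (size lam)) mu).
have := count_size (leq 2) (filter (leq 1) lam).
rewrite size_map; lia.
Qed.

Lemma size_spread (r : nat) (mu : seq nat) : 0 < r -> 1 < size mu ->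
  size (spread r mu) = r.+1 * (size mu).-1.
Proof. by move=> r0 m2; rewrite /= size_cat size_map size_behead size_nseq; nia. Qed.

Lemma spread_target (n r : nat) (mu : seq nat) : valid n (nseq r 0, mu) ->
  1 < r -> 1 < size mu <= r -> target n (r, spread r mu).
Proof.
case/and5P=> /= _ sm + _ /eqP sn r2 /andP[m2 mr].
rewrite (_ : head 0 _ = 0) ?size_nseq; last by case: (r).
rewrite add0n => amu; move: sn; rewrite sumn_nseq size_nseq.
case: mu sm amu m2 mr => // x mu; rewrite sorted_geq_cons => /andP[xmu sm] /= /andP[rx amu] m2 mr sn.
have a1 : all (leq r.-1) mu by apply: sub_all amu => y; lia.
apply/and3P; split.
- rewrite /spread sorted_geq_cons sorted_geq_cat sorted_map_subn // sorted_nseq !andbT.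
  apply/andP; split=> /=.
    rewrite all_cat all_map all_nseq; apply/andP; split; last by rewrite /=; lia.
    by apply/allP => y ym /=; have := allP xmu y ym => /=; lia.
  apply/allrelP => y z /mapP[u /(allP amu) /= ru ->] /nseqP[-> _] /=; lia.
- rewrite /= all_cat all_map all_nseq orbT andbT; apply/andP; split; first by lia.
  by apply: sub_all amu => y /=; lia.
(* With m parts in all, the loss is (m - 2) + (r - 1)(m - 1) = (r + 1)(m - 1) - m, the number of
   parts 1 added. *)
- rewrite /= sumn_cat sumn_nseq; have := sumn_map_subn a1; nia.
Qed.

Lemma backward_spread (n r : nat) (mu : seq nat) : all (leq r) mu ->
  1 < r -> 1 < size mu <= r -> backward n (r, spread r mu) = (nseq r 0, mu).
Proof.
move=> amu r2 /andP[m2 mr].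
have szL := size_spread (ltnW r2) m2.
have ones : r.+1 * (size mu).-1 - size mu <= count_mem 1 (spread r mu).
  by rewrite /spread /= count_cat count_mem1_nseq; lia.
have K : unspread r (spread r mu) = (nseq r 0, mu).
  rewrite /unspread szL mulKn // {ones szL}; congr pair.
  case: mu amu m2 mr => // x mu /= /andP[rx amu] m2 mr.
  rewrite take_size_cat ?size_map // map_subnK; first by congr (_ :: _); lia.
  by apply: sub_all amu => y; lia.
rewrite /backward (gtn_eqF (ltnW r2)) (gtn_eqF r2).
rewrite ifF; last by rewrite szL; nia.
rewrite ifF; last first.
  by apply/negP => /= /andP[_]; rewrite all_cat all_nseq => /andP[_]; nia.
(* For [r = 3] there are 2 or 3 parts, and at least two parts 1 are appended. *)
rewrite ifF; last by apply/negP => /andP[/eqP r3]; nia.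
by rewrite szL dvdn_mulr // ifT //; nia.
Qed.

Lemma hook_target (n r : nat) (mu : seq nat) : 373 <= n -> valid n (nseq r 0, mu) ->
  target n (hook_rank n, hook n r).
Proof.
move=> n373 /and5P[_ _ _ _ /eqP] /=; rewrite sumn_nseq size_nseq => sn.
have big : (hook_rank n).+1 * (12 + r) <= (n - hook_rank n ^ 2)./2.
  (* This is what rank 3 requires, and it is more than rank 2 does. Up to [r = 33] it follows from 8
     * 33 + 105 = 369, beyond that from [r ^ 2 <= n]. *)
  rewrite /hook_rank; have : 8 * r + 105 <= n by case: (leqP r 33) => h; nia.
  by case: (odd n) => /=; lia.
apply/and3P; split.
- rewrite sorted_geq_cons sorted_nseq andbT; apply/allP => x /nseqP[-> _] /=; lia.
- by rewrite /= all_nseq orbT.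
- rewrite /= sumn_nseq; move: big; rewrite /hook_rank; case: (boolP (odd n)) => on /=; lia.
Qed.

(** The factor [12 + r] exceeds [r0 - 1], so the hook is not mistaken for an image of [spread]. *)
Lemma backward_hook (n r : nat) :
  backward n (hook_rank n, hook n r) = (nseq r 0, [:: (n - r ^ 2)./2]).
Proof.
have szL : size (hook n r) = (hook_rank n).+1 * (12 + r).
  by rewrite /= size_nseq; lia.
have K : unhook n (hook_rank n) (hook n r) = (nseq r 0, [:: (n - r ^ 2)./2]).
  by rewrite /unhook szL mulKn // addKn.
have ones : 1 < count_mem 1 (hook n r).
  by rewrite /hook /= count_mem1_nseq; lia.
have h3 : 1 < hook_rank n <= 3 by rewrite /hook_rank; case: (odd n).
have /andP[h2 _] := h3; rewrite /backward (gtn_eqF (ltnW h2)) (gtn_eqF h2) szL.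
rewrite ifF; last by nia.
rewrite ifF; last by rewrite /hook -cat1s all_cat all_nseq; apply/negP => /andP[_]; nia.
rewrite ifF; last by lia.
by rewrite ifT ?dvdn_mulr // ifF //; nia.
Qed.

(** * Odd n, one odd part *)

(** At most 6 parts share a sum of at least (373 - 1) / 2 = 186, so the largest is at least 31 = 16
    + 3 * 5; the bound 373 is exactly enough here. *)
Lemma squeeze_few_shape (n a : nat) (mu : seq nat) : 373 <= n ->
  valid n ([:: a], mu) -> 0 < a -> size mu < 6 ->
  exists h rest, [/\ rcons mu a = h :: rest, sorted geq rest, all (leq 1) rest,
    16 + 3 * size rest <= h & (h + sumn rest).*2 + 1 = n].
Proof.
move=> n373 /and5P[/= _ sm amu pmu /eqP sn] a0 m5.
have snu : sorted geq (rcons mu a).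
  rewrite -cats1 sorted_geq_cat sm !andbT; apply/allrelP => x y xm.
  by rewrite inE => /eqP->; have := allP amu x xm => /=; lia.
have pnu : all (leq 1) (rcons mu a) by rewrite all_rcons a0.
have := sumn_le_head snu; move: snu pnu (size_rcons mu a) (sumn_rcons mu a).
case: (rcons mu a) => [//|h rest]; rewrite sorted_geq_cons => /andP[_ sr] /= /andP[_ pr] [szr] sumr le.
exists h, rest; split=> //; first by rewrite szr; nia.
by lia.
Qed.

Lemma squeeze_few_target (n a : nat) (mu : seq nat) : 373 <= n ->
  valid n ([:: a], mu) -> 0 < a -> size mu < 6 -> target n (3, squeeze_few mu a).
Proof.
move=> n373 v a0 m5; have [h [rest [E sr pr hh sn]]] := squeeze_few_shape n373 v a0 m5.
rewrite /squeeze_few E /=; have [<-] : (size rest).+1 = (size mu).+1.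
  by rewrite -(size_rcons mu a) E.
set B := h - _ - _; apply/and3P; split=> /=.
- rewrite !sorted_geq_cat sorted_map_addn // !sorted_nseq !andbT; apply/andP; split.
    apply/allrelP => x y /mapP[z /(allP pr) z1 ->]; rewrite mem_cat.
    by case/orP=> /nseqP[-> _] /=; lia.
  by apply/allrelP => x y /nseqP[-> _] /nseqP[-> _].
- by rewrite !all_cat all_map !all_nseq !orbT !andbT; apply/allP => x _ /=; lia.
(* The 4 subtracted in [B] is (3^2 - 1^2) / 2, the cost of passing from one odd part to three. *)
- by rewrite !sumn_cat !sumn_nseq sumn_map_addn; case: (boolP (odd B)) => oB; lia.
Qed.

Lemma backward_squeeze_few (n a : nat) (mu : seq nat) : 373 <= n ->
  valid n ([:: a], mu) -> 0 < a -> size mu < 6 ->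
  backward n (3, squeeze_few mu a) = ([:: a], mu).
Proof.
move=> n373 v a0 m5; have [h [rest [E sr pr hh sn]]] := squeeze_few_shape n373 v a0 m5.
have [szr] : (size rest).+1 = (size mu).+1 by rewrite -(size_rcons mu a) E.
set k := squeeze_few mu a; pose B := h - 4 - 3 * size rest.
have kE : k = map (addn 3) rest ++ nseq (odd B) 3 ++ nseq (B - 3 * odd B)./2 2.
  by rewrite /k /squeeze_few E -szr.
have B12 : 12 <= B by rewrite /B; lia.
(* Four parts 2 already make the length exceed 3. *)
have x4 : 4 <= (B - 3 * odd B)./2 by case: (odd B); lia.
have f4 : filter (leq 4) k = map (addn 3) rest.
  rewrite kE !filter_cat !filter_nseq !cats0; apply/all_filterP.
  by rewrite all_map; apply: sub_all pr => x /=; lia.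
have fC : filter (predC (leq 4)) k = nseq (odd B) 3 ++ nseq (B - 3 * odd B)./2 2.
  rewrite kE !filter_cat !filter_nseq !mul1n -[RHS]cat0s; congr (_ ++ _).
  apply/eqP; rewrite -size_eq0 size_filter count0 // => y /mapP[z /(allP pr) z1 ->] /=; lia.
have K : unsqueeze_few k = ([:: a], mu).
  rewrite /unsqueeze_few f4 fC -map_comp (eq_map (g := id)); last by move=> y; rewrite /= addKn.
  rewrite map_id sumn_cat !sumn_nseq.
  rewrite (_ : 3 * odd B + _ + 4 + _ = h); last by rewrite /B; case: (boolP (odd B)) => oB; lia.
  by rewrite -E last_rcons szr -cats1 take_size_cat.
have c0 : count_mem 1 k = 0.
  apply: count0 => y; rewrite kE !mem_cat => /or3P[/mapP[z /(allP pr) z1 ->]|/nseqP[->]|/nseqP[->]] //=.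
rewrite /backward /= c0 /= ifF; last by rewrite kE !size_cat !size_nseq; lia.
by rewrite ifF // kE !all_cat !all_nseq /=; apply/negP => /and3P[_ _]; lia.
Qed.

Lemma squeeze_twos_target (n : nat) (t : seq nat) :
  valid n ([:: 1], t ++ [:: 2; 2]) -> target n (3, rcons t 1).
Proof.
case/and5P => _ /= + _; rewrite sorted_geq_cat all_cat sumn_cat => /and3P[_ st _] /andP[pt _] /= /eqP sn.
apply/and3P; split=> /=.
- rewrite -cats1 sorted_geq_cat st !andbT; apply/allrelP => x y /(allP pt).
  by rewrite inE => ? /eqP->.
- by rewrite all_rcons pt.
- by rewrite sumn_rcons; lia.
Qed.

Lemma backward_squeeze_twos (n : nat) (t : seq nat) : 2 < size t ->
  valid n ([:: 1], t ++ [:: 2; 2]) ->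
  backward n (3, rcons t 1) = ([:: 1], t ++ [:: 2; 2]).
Proof.
move=> t3 /and5P[_ _ /= + _ _]; rewrite all_cat => /andP[at2 _].
(* Every part of [mu] is at least lam_1 + 1 = 2, so the appended 1 is alone. *)
have c1 : count_mem 1 (rcons t 1) = 1.
  rewrite -cats1 count_cat count0 // => y /(allP at2) /=; lia.
rewrite /backward c1 /= size_rcons /= -[X in take _ X]cats1 take_size_cat //.
by rewrite ifF ?all_rcons //; lia.
Qed.

Lemma squeeze_target (n a : nat) (mu : seq nat) : 373 <= n ->
  valid n ([:: a], mu) -> 0 < a -> target n (3, squeeze mu a).
Proof.
move=> n373 v a0; rewrite /squeeze; case: ltnP => m6; first exact: squeeze_few_target.
case: ifP => [/andP[/eqP a1 /eqP e2]|_].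
  by move: v; rewrite a1 -{1}(cat_take_drop (size mu - 2) mu) e2; apply: squeeze_twos_target.
case/and5P: v => /= _ sm amu _ /eqP sn; apply/and3P; split=> /=.
- have pE : map predn mu = map (subn^~ 1) mu by apply: eq_map => y; rewrite /= subn1.
  rewrite pE sorted_geq_cat sorted_map_subn // sorted_geq_cons sorted_nseq andbT /=.
  apply/andP; split; last by apply/allP => x /nseqP[-> _].
  apply/allrelP => x y /mapP[z /(allP amu) /= za ->].
  by rewrite inE => /orP[/eqP->|/nseqP[-> _]] /=; lia.
- rewrite all_cat /= a0 all_nseq orbT !andbT all_map; apply: sub_all amu => x /=; lia.
- have /sumn_map_subn : all (leq 1) mu by apply: sub_all amu => x /=; lia.
  rewrite (eq_map (g := predn)) => [|y]; last by rewrite /= subn1.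
  rewrite sumn_cat /= sumn_nseq; lia.
Qed.

Lemma backward_squeeze (n a : nat) (mu : seq nat) : 373 <= n ->
  valid n ([:: a], mu) -> 0 < a -> backward n (3, squeeze mu a) = ([:: a], mu).
Proof.
move=> n373 v a0; rewrite /squeeze; case: ltnP => m6; first exact: backward_squeeze_few.
case: ifP => [/andP[/eqP a1 /eqP e2]|nends].
  have e := cat_take_drop (size mu - 2) mu; rewrite e2 in e.
  rewrite a1 -{3}e; apply: backward_squeeze_twos; last by rewrite e -a1.
  by rewrite size_take; case: ifP; lia.
case/and5P: v => /= _ sm amu _ _.
set k := _ ++ _.
have szk : size k = 2 * size mu - 3.
  by rewrite size_cat size_map /= size_nseq; lia.
have pm : all (leq 1) mu by apply: sub_all amu => x /=; lia.
have K : unsqueeze k = ([:: a], mu).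
  rewrite /unsqueeze szk (_ : (_ + 3)./2 = size mu); last by lia.
  rewrite nth_cat size_map ltnn subnn take_size_cat ?size_map // -map_comp.
  congr pair; rewrite -[RHS]map_id; apply/eq_in_map => x /(allP pm) /=; lia.
have ones : size mu - 4 <= count_mem 1 k.
  by rewrite count_cat /= count_mem1_nseq; lia.
(* Only a part 2 of [mu] drops to 1. Two of them would force [a = 1] and a final [[:: 2; 2]], which
   is the branch already treated. *)
have big : (size mu).-1 <= count (leq 2) k.
  suff : all (leq 3) (take (size mu).-1 mu).
    move=> h; rewrite count_cat -(cat_take_drop (size mu).-1 mu) map_cat count_cat.
    have -> : count (leq 2) (map predn (take (size mu).-1 mu)) = (size mu).-1.
      rewrite count_map (eq_in_count (a2 := predT)) => [|x /(allP h) /=]; last by lia.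
      by rewrite count_predT size_takel // leq_pred.
    by rewrite !cat_take_drop -addnA leq_addr.
  case/lastP: mu sm amu m6 nends {pm k szk K ones} => // t x.
  case/lastP: t => [|t y]; first by move=> ? ?.
  rewrite -!cats1 -catA /= => sm amu m6 nends.
  have sz : size (t ++ [:: y; x]) = (size t).+2 by rewrite size_cat addn2.
  have dr : drop (size t) (t ++ [:: y; x]) = [:: y; x] by rewrite drop_size_cat.
  move: nends; rewrite /ends_two_twos sz subn2 /= dr.
  move: sm; rewrite sorted_geq_cat /= => /and3P[/allrelP ty _ /andP[xy _]].
  move: amu; rewrite all_cat /= => /and4P[_ ay ax _] nends.
  have y3 : 3 <= y.
    rewrite leqNgt; apply/negP => y2; move: nends.
    by have -> : y = 2; [lia | have -> : x = 2; [lia | have -> : a = 1; [lia |]]].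
  rewrite (_ : t ++ [:: y; x] = rcons t y ++ [:: x]); last by rewrite -cats1 -catA.
  rewrite take_size_cat ?size_rcons // all_rcons y3; apply/allP => z zt.
  by have := ty z y zt (mem_head _ _) => /=; lia.
rewrite /backward /= ifF; last by lia.
rewrite ifF; last first.
  by rewrite all_cat /= all_nseq; apply/negP => /and3P[_ _]; lia.
rewrite ifF; last by apply/negbTE; rewrite -ltnNge (leq_trans _ ones) //; lia.
(* An odd number of parts is not a multiple of 4. *)
rewrite ifF; last by rewrite szk; apply/negP => /dvdnP[q]; lia.
(* With m parts in [mu], (2m - 3) + 9 < 4 (m - 1) holds exactly from m = 6 on, hence the threshold
   in [squeeze]. *)
by rewrite ifT // szk (leq_trans _ (leq_mul (leqnn 4) big)) //; lia.
Qed.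

(** * Conclusion *)

Lemma forwardP (n : nat) (d : seq nat * seq nat) : 373 <= n -> valid n d ->
  target n (forward n d) && (backward n (forward n d) == d).
Proof.
move=> n373; case: d => lam mu v; rewrite /forward.
have /and5P[/= sl sm amu pmu /eqP sn] := v.
case: ifP => [/eqP/size0nil l0|l0].
  by rewrite l0 in sn *; rewrite /target /= sm pmu -sn !eqxx.
case: ifP => [|l1].
  case: lam sl amu sn v {l0} => [|a []] //= _ amu sn v _.
  case: ifP => [/eqP a0|/negbT]; last first.
    by rewrite -lt0n => a0; rewrite (squeeze_target n373 v a0) (backward_squeeze n373 v a0) eqxx.
  by rewrite /target /= sm pmu -sn a0 !eqxx.
have r2 : 1 < size lam by case: (size lam) l0 l1 => [|[]].
case: ifP => [/andP[/eqP h0 mu0]|/negbT]; last first.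
  rewrite negb_and negbK -lt0n => ne.
  by rewrite shear_target // backward_shear // eqxx.
have lam0 := sorted_geq_head0 sl h0.
have amu' : all (leq (size lam)) mu by move: amu; rewrite h0.
rewrite lam0 in v *; rewrite -lam0.
case: ifP => [/eqP m1|m1].
  rewrite (hook_target n373 v) backward_hook /=; apply/eqP.
  rewrite -lam0; congr pair; case: mu m1 sn {v mu0 sm amu pmu amu'} => [|x []] //= _ <-.
  by congr [:: _]; rewrite lam0 sumn_nseq size_nseq; lia.
have m2 : 1 < size mu by move: m1 mu0; rewrite -size_eq0; case: (size mu) => [|[]].
case: leqP => mr.
  by rewrite (spread_target v r2) ?m2 // backward_spread ?m2 // -lam0 eqxx.
have s0 : sumn lam = 0 by rewrite lam0 sumn_nseq.
rewrite /target /= sm pmu -sn s0 add0n eqxx /=.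
by rewrite (gtn_eqF (ltnW r2)) (gtn_eqF r2) leqNgt mr /= amu' -lam0 eqxx.
Qed.

Theorem theorem1p2 (n : nat) : 373 <= n -> p_od_eu n < p_eu_od n.
Proof.
move=> n373; pose w := (hook_rank n, hook n 0).
have tw : target n w.
  apply/and3P; split.
  - rewrite sorted_geq_cons sorted_nseq andbT; apply/allP => x /nseqP[-> _] /=; lia.
  - by rewrite /= all_nseq orbT.
  - rewrite /= sumn_nseq /hook_rank; case: (boolP (odd n)) => on /=; lia.
apply: (@card_parts_lt n cond_od_eu cond_eu_od
  (fun s => encode (forward n (decode s))) (encode w)).
- move=> s ps cs; have vs := decode_valid ps cs.
  have /andP[ts /eqP ks] := forwardP n373 vs.
  (* A preimage of [w] would have no odd part, but [forward] then returns rank 0 instead of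
     [hook_rank n]. *)
  have /andP[-> ->] := encodeP ts; apply/eqP => /(encode_inj ts tw) e.
  move: ks; rewrite e backward_hook => ks.
  by move: e; rewrite -ks.
- move=> s t ps pt e; apply: (decode_inj ps pt).
  case/andP: ps pt => ps cs /andP[pt ct].
  have /andP[ts /eqP <-] := forwardP n373 (decode_valid ps cs).
  have /andP[tt /eqP <-] := forwardP n373 (decode_valid pt ct).
  by rewrite (encode_inj ts tt e).
- by case/andP: (encodeP tw).
- by case/andP: (encodeP tw).
Qed.
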